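(* Let $a,b_1,b_2,c,t_1,t_2\in\mathbb{C}$ with $\Re(c)\ne0,-1,-2,\dots$, let $k_1,k_2,r\in\mathbb{N}$, and let $|x|<1$, $|y|<1$. Then $$(\Delta_{t_1})^r\,\mathcal{F}_1^{(1)}(a,b_1,b_2;c;t_1,t_2,1,k_2,x,y)=\frac{(a)_r(b_1)_r\,x^r}{(c)_r}\,\mathcal{F}_1^{(1)}(a+r,b_1+r,b_2;c+r;t_1,t_2,1,k_2,x,y)$$ and $$(\Delta_{t_2})^r\,\mathcal{F}_1^{(1)}(a,b_1,b_2;c;t_1,t_2,k_1,1,x,y)=\frac{(a)_r(b_2)_r\,y^r}{(c)_r}\,\mathcal{F}_1^{(1)}(a+r,b_1,b_2+r;c+r;t_1,t_2,k_1,1,x,y).$$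
   Context: $\mathbb{N}$ is the set of natural numbers. The Pochhammer symbol is $(u)_0=1$, $(u)_k=u(u+1)\cdots(u+k-1)$ for $k\ge1$. The first discrete Appell function is $$\mathcal{F}_1^{(1)}(a,b_1,b_2;c;t_1,t_2,k_1,k_2,x,y)=\sum_{m,n\ge 0}\frac{(a)_{m+n}(b_1)_m(b_2)_n(-1)^{mk_1}(-1)^{nk_2}(-t_1)_{mk_1}(-t_2)_{nk_2}}{(c)_{m+n}\,m!\,n!}x^my^n .$$ $\Delta_tf(t)=f(t+1)-f(t)$ is the forward difference operator in the variable $t$, and $(\Delta_t)^r$ is its $r$-fold iterate.
   Formalization: For |x|,|y|<1 the double series generally diverges, so each identity is stated assuming absolute convergence of the left-hand series at t_i, t_i+1, ..., t_i+r; it is also stated, with no convergence assumption, as an identity of formal power series in x and y. *)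

(* Defs.v *)
From HB Require Import structures.
From mathcomp Require Import all_boot all_order all_algebra.
From mathcomp Require Import finmap.
From mathcomp Require Import all_classical all_reals all_analysis.
From mathcomp Require Import summability.
From mathcomp Require Import complex.

Set Implicit Arguments.
Unset Strict Implicit.
Unset Printing Implicit Defensive.

Import Order.TTheory GRing.Theory Num.Theory.
Import numFieldNormedType.Exports.

Local Open Scope classical_set_scope.
Local Open Scope ring_scope.
Local Open Scope complex_scope.

Section DiscreteAppell.
Context {R : realType}.

Definition pochhammer (u : R[i]) (k : nat) : R[i] := \prod_(i < k) (u + i%:R).

(* [V] is [R[i]] for numerical values and [nat * nat -> R[i]] for formal power
   series. *)
Definition fdiff (V : zmodType) (f : R[i] -> V) : R[i] -> V :=
  fun t => f (t + 1) - f t.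

(* The double series as an element of C[[x, y]], the pair [(m, n)] indexing the
   monomial x^m y^n. *)
Definition appellF1_coef (a b1 b2 c t1 t2 : R[i]) (k1 k2 : nat) :
    nat * nat -> R[i] :=
  fun p => let: (m, n) := p in
    pochhammer a (m + n) * pochhammer b1 m * pochhammer b2 n
    * (-1) ^+ (m * k1) * (-1) ^+ (n * k2)
    * pochhammer (- t1) (m * k1) * pochhammer (- t2) (n * k2)
    / (pochhammer c (m + n) * m`!%:R * n`!%:R).

(* Multiplication by x^r y^s in C[[x, y]]. *)
Definition fps_mulXY (r s : nat) (f : nat * nat -> R[i]) : nat * nat -> R[i] :=
  fun p => if (r <= p.1)%N && (s <= p.2)%N then f (p.1 - r, p.2 - s)%N else 0.

(* The topology used on R[i] is the one of its norm, which the library attaches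
   to the alias R[i]^o. *)
Definition appellF1_term (a b1 b2 c t1 t2 : R[i]) (k1 k2 : nat)
    (x y : R[i]) : nat * nat -> R[i]^o :=
  fun p => appellF1_coef a b1 b2 c t1 t2 k1 k2 p * x ^+ p.1 * y ^+ p.2.

(* Convergence of the net of finite partial sums, which over C is the same as
   absolute convergence of the double series. *)
Definition appellF1_cvg (a b1 b2 c t1 t2 : R[i]) (k1 k2 : nat)
    (x y : R[i]) : Prop :=
  cvg (partial_sum (appellF1_term a b1 b2 c t1 t2 k1 k2 x y) @ totally).

(* The limit of the same net, meaningful only under [appellF1_cvg]. *)
Definition appellF1 (a b1 b2 c t1 t2 : R[i]) (k1 k2 : nat)
    (x y : R[i]) : R[i] :=
  sum (appellF1_term a b1 b2 c t1 t2 k1 k2 x y).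

End DiscreteAppell.

(* Main.v *)
Require Import Defs.
From mathcomp Require Import all_boot all_order all_algebra.
From mathcomp Require Import all_classical all_reals all_analysis.
From mathcomp Require Import complex.
From mathcomp Require Import finmap summability ring.

Set Implicit Arguments.
Unset Strict Implicit.
Unset Printing Implicit Defensive.

Import Order.TTheory GRing.Theory Num.Theory.
Import numFieldNormedType.Exports.
Local Open Scope ring_scope.
Local Open Scope complex_scope.

(** For k_1 = 1 the variable t_1 enters the (m, n) coefficient only through the
    falling factorial (-1)^m (-t_1)_m = t_1 (t_1 - 1) ... (t_1 - m + 1), whose
    r-th forward difference is m! / (m - r)! times the falling factorial of
    order m - r.  With (u)_{r+k} = (u)_r (u + r)_k this gives the coefficient
    identity; the second one follows by exchanging the two variables.  For the
    sums, differences commute with the limit of the finite partial sums, and the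
    index shift by r only discards vanishing terms. *)

Section FiniteDifference.
Context {R : realType}.
Implicit Types (t u : R[i]) (m n r : nat).

Lemma iter_fdiff_fct (I : Type) (V : zmodType) (f : R[i] -> (I -> V)) r t i :
  iter r (@fdiff R (I -> V : zmodType)) f t i = iter r (@fdiff R V) (f^~ i) t.
Proof. by elim: r t => //= r IH t; rewrite /fdiff -!IH. Qed.

(** In the applications [g] multiplies by a factor free of the difference variable, written
    [_ \*o idfun] so that its additivity is inferred. *)
Lemma iter_fdiff_additive (V W : zmodType) (g : {additive V -> W})
    (f : R[i] -> V) r t :
  iter r (@fdiff R W) (g \o f) t = g (iter r (@fdiff R V) f t).
Proof. by elim: r t => //= r IH t; rewrite /fdiff !IH raddfB. Qed.

Lemma pochhammerD u m n :
  pochhammer u (m + n) = pochhammer u m * pochhammer (u + m%:R) n.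
Proof.
rewrite /pochhammer big_split_ord; congr (_ * _).
by apply: eq_bigr => i _; rewrite /= natrD addrA.
Qed.

Lemma pochhammer1 u : pochhammer u 1 = u.
Proof. by rewrite /pochhammer big_ord1 addr0. Qed.

(* Unfolds to t (t - 1) ... (t - m + 1). *)
Definition falling m t : R[i] := (-1) ^+ m * pochhammer (- t) m.

Lemma fdiff_falling m : fdiff (falling m) = (fun t => m%:R * falling m.-1 t).
Proof.
apply/funext => t; rewrite /fdiff /falling.
case: m => [|m] /=; first by rewrite /pochhammer !big_ord0 subrr mul0r.
(* Both terms of the difference then share the factor (-t)_m, with cofactors -(t + 1) and -t + m,
   whose difference is -(m + 1). *)
have -> : pochhammer (- (t + 1)) m.+1 = - (t + 1) * pochhammer (- t) m.
  rewrite -add1n pochhammerD pochhammer1; congr (_ * pochhammer _ m); ring.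
rewrite -[in X in _ - X]addn1 pochhammerD pochhammer1 addn1 exprS -natr1.
ring.
Qed.

(* For r > m both sides vanish, since then m ^_ r = 0. *)
Lemma iter_fdiff_falling r m t :
  iter r (@fdiff R R[i]) (falling m) t = (m ^_ r)%:R * falling (m - r) t.
Proof.
elim: r m t => [|r IH] m t; first by rewrite ffactn0 mul1r subn0.
rewrite iterSr fdiff_falling.
rewrite (iter_fdiff_additive (m%:R \*o idfun) (falling m.-1)) /= IH mulrA -natrM ffactnS.
by case: m => [|m]; rewrite ?mul0n ?mul0r // subSS.
Qed.

Lemma iter_fdiff_coef (a b1 b2 c t1 t2 : R[i]) (k2 r : nat) p :
  iter r (@fdiff R R[i]) (fun t => appellF1_coef a b1 b2 c t t2 1 k2 p) t1
  = pochhammer a r * pochhammer b1 r / pochhammer c r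
    * fps_mulXY r 0
        (appellF1_coef (a + r%:R) (b1 + r%:R) b2 (c + r%:R) t1 t2 1 k2) p.
Proof.
case: p => m n; rewrite /fps_mulXY /= leq0n andbT subn0.
(* [C] gathers everything in the coefficient that is free of the difference variable. *)
set C := pochhammer a (m + n) * pochhammer b1 m * pochhammer b2 n
  * (-1) ^+ (n * k2) * pochhammer (- t2) (n * k2)
  / (pochhammer c (m + n) * m`!%:R * n`!%:R).
have -> : (fun t => pochhammer a (m + n) * pochhammer b1 m * pochhammer b2 n
    * (-1) ^+ (m * 1) * (-1) ^+ (n * k2)
    * pochhammer (- t) (m * 1) * pochhammer (- t2) (n * k2)
    / (pochhammer c (m + n) * m`!%:R * n`!%:R)) = C \*o idfun \o falling m.
  by apply/funext => t; rewrite /C /falling /= !muln1; ring.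
rewrite iter_fdiff_additive /= iter_fdiff_falling.
have [rm|mr] := leqP r m; last by rewrite ffact_small // mul0r !mulr0.
have fm : m`!%:R^-1 * (m ^_ r)%:R = ((m - r)`!%:R : R[i])^-1.
  have f0 k : (k`!%:R : R[i]) != 0 by rewrite pnatr_eq0 -lt0n fact_gt0.
  apply: (mulfI (f0 m)); rewrite mulVKf // -(ffact_fact rm) natrM.
  by rewrite mulfK.
have E u : pochhammer u (m + n) =
    pochhammer u r * pochhammer (u + r%:R) (m - r + n).
  by rewrite -pochhammerD addnA subnKC.
have Eb : pochhammer b1 m = pochhammer b1 r * pochhammer (b1 + r%:R) (m - r).
  by rewrite -pochhammerD subnKC.
(* Inverting the product (c)_r (c + r)_(m - r + n) factor by factor is valid even at zero factors,
   since 0^-1 = 0. *)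
rewrite /C !E Eb /falling !muln1 !invfM -fm.
by ring.
Qed.

Lemma appellF1_coef_swap (a b1 b2 c t1 t2 : R[i]) (k1 k2 m n : nat) :
  appellF1_coef a b1 b2 c t1 t2 k1 k2 (m, n)
  = appellF1_coef a b2 b1 c t2 t1 k2 k1 (n, m).
Proof.
rewrite /appellF1_coef (addnC n) (mulrAC _ _ n`!%:R).
by congr (_ / _); ring.
Qed.

Lemma iter_fdiff_coef_swap (a b1 b2 c t1 t2 : R[i]) (k1 r : nat) p :
  iter r (@fdiff R R[i]) (fun t => appellF1_coef a b1 b2 c t1 t k1 1 p) t2
  = pochhammer a r * pochhammer b2 r / pochhammer c r
    * fps_mulXY 0 r
        (appellF1_coef (a + r%:R) b1 (b2 + r%:R) (c + r%:R) t1 t2 k1 1) p.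
Proof.
case: p => m n.
have -> : (fun t => appellF1_coef a b1 b2 c t1 t k1 1 (m, n)) =
    (fun t => appellF1_coef a b2 b1 c t t1 1 k1 (n, m)).
  by apply/funext => t; exact: appellF1_coef_swap.
rewrite iter_fdiff_coef; congr (_ * _).
rewrite /fps_mulXY !leq0n andbT !subn0.
by case: ifP => // _; exact: appellF1_coef_swap.
Qed.

End FiniteDifference.

Section UnconditionalSums.
Local Open Scope classical_set_scope.
Local Open Scope fset_scope.
Local Open Scope ring_scope.
#[local] Existing Instance totally_filter.
Context {K : numFieldType} {V : normedModType K}.

Lemma partial_sumE (I : choiceType) (f : I -> V) (A : {fset I}) :
  partial_sum f A = \sum_(i <- A) f i.
Proof. by rewrite /partial_sum big_seq_fsetE. Qed.

Lemma cvg_sum (I : choiceType) (f : I -> V) (l : V) :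
  partial_sum f @ totally --> l -> summability.sum f = l.
Proof. by move=> fl; apply: cvg_lim => //; exact: (@norm_hausdorff _ V). Qed.

(* Every finite set B of indices of [h] is matched by the larger finite set
   A `|` phi @` B of indices of [g], whose extra elements all lie off the range
   of [phi]. *)
Lemma cvg_partial_sum_reindex (I J : choiceType) (phi : J -> I) (psi : I -> J)
    (g : I -> V) (h : J -> V) (l : V) :
  cancel phi psi -> (forall j, g (phi j) = h j) ->
  (forall i, phi (psi i) <> i -> g i = 0) ->
  partial_sum g @ totally --> l -> partial_sum h @ totally --> l.
Proof.
move=> phiK gh g0 gl U /gl [A _ AU].
(* Once B contains [psi @] A[, every i in A with]phi (psi i) = i[lies in]phi @[B], so [g] vanishes
   on the rest of A. *)
exists (psi @` A) => // B /= AB.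
suff -> : partial_sum h B = partial_sum g (A `|` phi @` B).
  by apply: AU => /=; exact: fsubsetUl.
rewrite !partial_sumE.
rewrite (big_fsetID _ (mem (phi @` B))) /=.
rewrite [X in _ + X]big1_fset ?addr0 => [|i].
  have -> : [fset i | i in A `|` phi @` B & i \in phi @` B] = phi @` B.
    by apply/fsetP => i; rewrite !inE; case: (_ \in _ @` _); rewrite ?orbT ?andbF.
  rewrite big_imfset /=; last by move=> ? ? _ _; exact: (can_inj phiK).
  by apply: eq_bigr => j _; rewrite gh.
rewrite !inE => /andP[/orP[iA|->//] iB] _.
apply: g0 => phii; move/negP: iB; apply.
rewrite -phii; apply: in_imfset => /=.
by apply: (fsubsetP AB); exact: in_imfset.
Qed.

(* [sum h] is junk when [h] is not summable, which is possible only if k = 0: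
   otherwise the summability of [h] is inherited from that of [g]. *)
Lemma sum_scale_reindex (I J : choiceType) (phi : J -> I) (psi : I -> J)
    (g : I -> V) (h : J -> V) (k : K) (l : V) :
  cancel phi psi -> (forall j, g (phi j) = k *: h j) ->
  (forall i, phi (psi i) <> i -> g i = 0) ->
  partial_sum g @ totally --> l -> l = k *: summability.sum h.
Proof.
move=> phiK gh g0 /(cvg_partial_sum_reindex phiK gh g0) khl.
have khE : partial_sum (fun j => k *: h j) = k \*: partial_sum h.
  by apply/funext => A; rewrite /= !partial_sumE scaler_sumr.
have [k0|k0] := eqVneq k 0.
  rewrite k0 scale0r -(cvg_sum khl); apply: cvg_sum.
  rewrite khE k0 (_ : _ \*: _ = cst 0); first exact: cvg_cst.
  by apply/funext => A /=; rewrite scale0r.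
rewrite (@cvg_sum _ h (k^-1 *: l)) ?scalerA ?divff ?scale1r //.
rewrite (_ : partial_sum h = k^-1 \*: partial_sum (fun j => k *: h j)).
  exact: cvgZl_tmp.
by rewrite khE; apply/funext => A /=; rewrite scalerA mulVf ?scale1r.
Qed.

(** The r-th difference at t reads only the values at t, t + 1, ..., t + r, which is where
    summability is assumed. The induction subtracts the limits obtained at t + 1 and at t. *)
Lemma cvg_iter_fdiff (R : realType) (I : choiceType) (f : R[i] -> I -> V) r t :
  (forall j, (j <= r)%N -> cvg (partial_sum (f (t + j%:R)) @ totally)) ->
  partial_sum (fun i => iter r (@fdiff R V) (f^~ i) t) @ totally -->
    iter r (@fdiff R V) (fun t => summability.sum (f t)) t.
Proof.
elim: r t => [|r IH] t fcvg.
  by have := fcvg 0%N isT; rewrite addr0.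
rewrite /= {1}/fdiff.
rewrite (_ : partial_sum _ =
    partial_sum (fun i => iter r (@fdiff R V) (f^~ i) (t + 1))
    - partial_sum (fun i => iter r (@fdiff R V) (f^~ i) t)).
  apply: cvgB; apply: IH => j jr; last exact: fcvg (leqW jr).
  by rewrite -addrA nat1r; exact: fcvg.
by apply/funext => A; rewrite !fctE !partial_sumE -sumrB.
Qed.

End UnconditionalSums.

Section PowerSeries.
Local Open Scope classical_set_scope.
Context {R : realType}.

(** Keeping [F], [G] and the shift abstract serves both variables at once; the monomial x^s y^s'
    comes out of the sum when the exponents are shifted by (s, s'). *)
Lemma iter_fdiff_power_series (F : R[i] -> nat * nat -> R[i])
    (G : nat * nat -> R[i]) (k x y t : R[i]) (r s s' : nat) :
  let S f : nat * nat -> R[i]^o := fun p => f p * x ^+ p.1 * y ^+ p.2 in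
  (forall p, iter r (@fdiff R R[i]) (F^~ p) t = k * fps_mulXY s s' G p) ->
  (forall j, (j <= r)%N -> cvg (partial_sum (S (F (t + j%:R))) @ totally)) ->
  iter r (@fdiff R R[i]) (fun t => summability.sum (S (F t))) t
  = k * x ^+ s * y ^+ s' * summability.sum (S G).
Proof.
move=> S diffF cvF.
pose phi (p : nat * nat) := (p.1 + s, p.2 + s')%N.
(* The subtraction is truncated, so [phi (psi p) = p] exactly when p passes the test in [fps_mulXY];
   all other terms are zero. *)
pose psi (p : nat * nat) := (p.1 - s, p.2 - s')%N.
have phiK : cancel phi psi by case=> m n; rewrite /phi /psi /= !addnK.
have diffS p : iter r (@fdiff R (R[i]^o)) (fun t => S (F t) p) t =
    k * fps_mulXY s s' G p * x ^+ p.1 * y ^+ p.2.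
  rewrite -diffF.
  have H := iter_fdiff_additive ((x ^+ p.1 * y ^+ p.2) \*o idfun) (F^~ p) r t.
  rewrite -mulrA mulrC -[RHS]H.
  by congr (iter r _ _ t); apply/funext => u; rewrite /S /= -mulrA mulrC.
apply: (sum_scale_reindex phiK _ _ (cvg_iter_fdiff cvF)) => [[m n]|[m n]] /=.
  rewrite diffS /fps_mulXY /phi /= !leq_addl !addnK /S /= !exprD.
  by rewrite [RHS]/GRing.scale /=; ring.
rewrite diffS /fps_mulXY /phi /psi /=; case: ifP => [/andP[sm sn]|_].
  by rewrite !subnK.
by rewrite mulr0 !mul0r.
Qed.

End PowerSeries.

Theorem mainTheorem5 (R : realType) (a b1 b2 c t1 t2 x y : R[i])
    (k1 k2 r : nat)
    (hc : forall n : nat, complex.Re c <> - n%:R)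
    (hx : `|x| < 1) (hy : `|y| < 1) :
  [/\
    (forall j : nat, (j <= r)%N ->
       appellF1_cvg a b1 b2 c (t1 + j%:R) t2 1 k2 x y) ->
    iter r (@fdiff R R[i])
      (fun t => appellF1 a b1 b2 c t t2 1 k2 x y) t1
    = pochhammer a r * pochhammer b1 r * x ^+ r / pochhammer c r
      * appellF1 (a + r%:R) (b1 + r%:R) b2 (c + r%:R) t1 t2 1 k2 x y,

    (forall j : nat, (j <= r)%N ->
       appellF1_cvg a b1 b2 c t1 (t2 + j%:R) k1 1 x y) ->
    iter r (@fdiff R R[i])
      (fun t => appellF1 a b1 b2 c t1 t k1 1 x y) t2
    = pochhammer a r * pochhammer b2 r * y ^+ r / pochhammer c r
      * appellF1 (a + r%:R) b1 (b2 + r%:R) (c + r%:R) t1 t2 k1 1 x y,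

    iter r (@fdiff R (nat * nat -> R[i] : zmodType))
      (fun t => appellF1_coef a b1 b2 c t t2 1 k2) t1
    = (pochhammer a r * pochhammer b1 r / pochhammer c r)
      *: fps_mulXY r 0
           (appellF1_coef (a + r%:R) (b1 + r%:R) b2 (c + r%:R) t1 t2 1 k2)
    &
    iter r (@fdiff R (nat * nat -> R[i] : zmodType))
      (fun t => appellF1_coef a b1 b2 c t1 t k1 1) t2
    = (pochhammer a r * pochhammer b2 r / pochhammer c r)
      *: fps_mulXY 0 r
           (appellF1_coef (a + r%:R) b1 (b2 + r%:R) (c + r%:R) t1 t2 k1 1)].
Proof.
split.
- move=> cv.
  rewrite (iter_fdiff_power_series (iter_fdiff_coef _ _ _ _ _ _ _ _) cv).
  by rewrite expr0 mulr1 (mulrAC _ _ (x ^+ r)).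
- move=> cv.
  rewrite (iter_fdiff_power_series (iter_fdiff_coef_swap _ _ _ _ _ _ _ _) cv).
  by rewrite expr0 mulr1 (mulrAC _ _ (y ^+ r)).
(* Differences of formal power series are taken coefficient by coefficient. *)
- by apply/funext => p; rewrite iter_fdiff_fct iter_fdiff_coef.
- by apply/funext => p; rewrite iter_fdiff_fct iter_fdiff_coef_swap.
Qed.
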